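(* Up to isomorphism there exist exactly $30$ unitally nondistributive quantales having exactly $7$ elements. Among these $30$ isomorphism classes, exactly $2$ consist of non-commutative quantales.
   Context: A quantale is a complete lattice with an associative binary operation $\ast$ preserving arbitrary joins in each variable separately; it is unital if $\ast$ has a two-sided unit $e$. Isomorphisms are lattice isomorphisms preserving $\ast$ (and hence the unit). Totally below relation on a complete lattice $L$: $\beta\vartriangleleft\alpha$ if for every $A\subseteq L$ with $\alpha\le\bigvee A$ there is $\gamma\in A$ with $\beta\le\gamma$. A unital quantale $(\mathfrak Q,\ast,e)$ is unitally nondistributive if (1) $\bigvee\{\alpha\in\mathfrak Q\mid\alpha\vartriangleleft e\}=e$ and (2) there is a subset $A\subseteq\mathfrak Q$ with $e\wedge(\bigvee A)\not\le\bigvee_{\alpha\in A}(e\wedge\alpha)$. *)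

(* Defs.v *)
From mathcomp Require Import all_boot all_order.
From mathcomp Require Import boolp classical_sets functions cardinality.

Set Implicit Arguments.
Unset Strict Implicit.
Unset Printing Implicit Defensive.

Local Open Scope classical_set_scope.

Definition complete_lattice d (T : porderType d) : Prop :=
  forall A : set T, supremums A !=set0 /\ infimums A !=set0.

(* [supremum x0 A] is x0 when A is empty or has no least upper bound; with
   x0 = \bot it is the join of every subset A of a complete lattice. *)
Definition bigjoin d (T : tbLatticeType d) (A : set T) : T :=
  supremum (\bot)%O A.

Record quantale := Quantale {
  qdisp : Order.disp_t;
  qsort :> tbLatticeType qdisp;
  qcomplete : complete_lattice qsort;
  qmul : qsort -> qsort -> qsort;
  qmulA : associative qmul;
  qmul_joinr : forall (a : qsort) (B : set qsort),
    qmul a (bigjoin B) = bigjoin [set qmul a b | b in B];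
  qmul_joinl : forall (A : set qsort) (b : qsort),
    qmul (bigjoin A) b = bigjoin [set qmul a b | a in A]
}.

Record unital_quantale := UnitalQuantale {
  uquantale :> quantale;
  qone : uquantale;
  qmul1q : left_id qone (@qmul uquantale);
  qmulq1 : right_id qone (@qmul uquantale)
}.

Definition isomorphic (Q1 Q2 : quantale) : Prop :=
  exists f : Q1 -> Q2,
    [/\ bijective f,
        {morph f : x y / (x `&` y)%O},
        {morph f : x y / (x `|` y)%O}
      & {morph f : x y / qmul x y}].

Definition commutative_quantale (Q : quantale) : Prop :=
  commutative (@qmul Q).

Definition totally_below d (T : tbLatticeType d) (b a : T) : Prop :=
  forall A : set T, (a <= bigjoin A)%O -> exists2 c, A c & (b <= c)%O.

Definition unitally_nondistributive (Q : unital_quantale) : Prop :=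
  bigjoin [set a : Q | totally_below a (qone Q)] = qone Q /\
  exists A : set Q,
    ~ (qone Q `&` bigjoin A <= bigjoin [set qone Q `&` a | a in A])%O.

Definition has_card (n : nat) (Q : quantale) : Prop :=
  ([set: Q] #= `I_n)%card.

(* The members of P fall into exactly n isomorphism classes. *)
Definition exactly_up_to_iso (n : nat) (P : unital_quantale -> Prop) : Prop :=
  exists rep : 'I_n -> unital_quantale,
    [/\ forall i, P (rep i),
        forall i j, isomorphic (rep i) (rep j) -> i = j
      & forall Q, P Q -> exists i, isomorphic Q (rep i)].

(* Main.v *)
(** A finite quantale is determined by its join and multiplication tables, and
    conditions (1) and (2) only mention finitely many joins.  Listing the seven
    elements along a linear extension of the order leaves at most 2^10 orders to
    inspect; only two lattices with a marked unit survive (1) and (2) up to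
    isomorphism.  On each of them the rows of a multiplication table are join
    endomorphisms whose value at the unit is prescribed, so that a short
    backtracking search finds all unital quantales: 18 tables on each lattice,
    forming 30 isomorphism classes. *)
Require Import Defs.
From HB Require Import structures.
From mathcomp Require Import all_boot all_order.
From mathcomp Require Import boolp classical_sets functions cardinality.

Set Implicit Arguments.
Unset Strict Implicit.
Unset Printing Implicit Defensive.

Import Order.TTheory.

(** * Bounded Boolean quantifiers and pruned search *)

(* Unlike [all] and [has], these stay lazy under call-by-value reduction. *)
Fixpoint allb T (P : T -> bool) (s : seq T) : bool :=
  if s is x :: s' then if P x then allb P s' else false else true.

Fixpoint hasb T (P : T -> bool) (s : seq T) : bool :=
  if s is x :: s' then if P x then true else hasb P s' else false.

Lemma allbE T (P : T -> bool) s : allb P s = all P s.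
Proof. by elim: s => //= x s ->; case: (P x). Qed.

Lemma hasbE T (P : T -> bool) s : hasb P s = has P s.
Proof. by elim: s => //= x s ->; case: (P x). Qed.

Definition all7 (P : nat -> bool) : bool := allb P (iota 0 7).
Definition all2_7 (P : nat -> nat -> bool) : bool := all7 (fun i => all7 (P i)).
Definition all3_7 (P : nat -> nat -> nat -> bool) : bool :=
  all7 (fun i => all2_7 (P i)).

Lemma allb_iotaP (P : nat -> bool) n :
  reflect (forall i, i < n -> P i) (allb P (iota 0 n)).
Proof.
rewrite allbE; apply: (iffP allP) => [hP i ltin|hP i]; last first.
  by rewrite mem_iota => /hP.
by apply: hP; rewrite mem_iota.
Qed.

Lemma all7P (P : nat -> bool) : reflect (forall i, i < 7 -> P i) (all7 P).
Proof. exact: allb_iotaP. Qed.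

Lemma all2_7P (P : nat -> nat -> bool) :
  reflect (forall i j, i < 7 -> j < 7 -> P i j) (all2_7 P).
Proof.
apply: (iffP (all7P _)) => [hP i j /hP/all7P + /[dup] jlt|hP i ilt].
  by move=> /(_ _ jlt).
by apply/all7P => j jlt; apply: hP.
Qed.

Lemma all3_7P (P : nat -> nat -> nat -> bool) :
  reflect (forall i j k, i < 7 -> j < 7 -> k < 7 -> P i j k) (all3_7 P).
Proof.
apply: (iffP (all7P _)) => [hP i j k /hP/all2_7P + jlt klt|hP i ilt].
  by move=> /(_ j k jlt klt).
by apply/all2_7P => j k jlt klt; apply: hP.
Qed.

(** Breadth-first backtracking: prefixes grow on the right and [ok] prunes at every length. The
    admissible values of an entry depend on its position only. *)
Fixpoint search (T : Type) (dom : nat -> seq T) (ok : seq T -> bool) n :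
    seq (seq T) :=
  if n is m.+1
  then [seq r <- [seq rcons s x | s <- search dom ok m, x <- dom m] | ok r]
  else [:: [::]].

(** Completeness of the search: pruning never loses a list all of whose prefixes pass. Soundness is
    obtained separately, by testing the final tables. *)
Lemma mkseq_search (T : eqType) (dom : nat -> seq T) (ok : pred (seq T)) (f : nat -> T) n :
    (forall k, k < n -> f k \in dom k) ->
    (forall k, k <= n -> ok (mkseq f k)) ->
  mkseq f n \in search dom ok n.
Proof.
elim: n => [//|n IHn] fdom fok; rewrite [search _ _ _]/= mem_filter fok//=.
rewrite mkseqS; apply: allpairs_f; last exact: fdom.
by apply: IHn => k kn; [apply: fdom; rewrite ltnS ltnW|apply: fok; rewrite leqW].
Qed.

(** * Join tables and decidable forms of the lattice conditions *)

Definition table := seq (seq nat).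
Definition op (t : table) (i j : nat) : nat := nth 0 (nth [::] t i) j.
Definition tle (J : table) i j := op J i j == j.
Definition tjoin (J : table) (P : nat -> bool) : nat :=
  foldr (op J) 0 (filter P (iota 0 7)).
Definition tmeet (J : table) i j : nat :=
  tjoin J (fun k => if tle J k i then tle J k j else false).

Definition mktable (f : nat -> nat -> nat) : table :=
  mkseq (fun i => mkseq (f i) 7) 7.

Lemma op_mkseq (f : nat -> nat -> nat) n i j :
  i < n -> j < 7 -> op (mkseq (fun i => mkseq (f i) 7) n) i j = f i j.
Proof. by move=> *; rewrite /op !nth_mkseq. Qed.

Definition latticeb (J : table) : bool :=
  [&& all2_7 (fun i j => op J i j < 7),
      all7 (fun i => [&& tle J i i, tle J 0 i & tle J i (tjoin J xpredT)]),
      all2_7 (fun i j => tle J i j && tle J j i ==> (i == j))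
    & all3_7 (fun i j k =>
        [&& tle J i j && tle J j k ==> tle J i k,
            tle J (op J i j) k == tle J i k && tle J j k
          & tle J i (tmeet J j k) == tle J i j && tle J i k])].

(** For condition (1), [b] is totally below [e] iff the join of all elements not above [b] is not
    above [e]. Condition (2) is tested on two-element sets, which suffice in a finite lattice. *)
Definition good (J : table) (e : nat) : bool :=
  if tjoin J (fun b => ~~ tle J e (tjoin J (fun c => ~~ tle J b c))) == e then
    ~~ all2_7 (fun a b =>
      tle J (tmeet J e (op J a b)) (op J (tmeet J e a) (tmeet J e b)))
  else false.

Local Open Scope order_scope.

(** * Arbitrary joins, and labellings of a seven-element lattice *)

Lemma bigjoin_eq d (T : tbLatticeType d) (A : set T) (x : T) :
  supremums A x -> bigjoin A = x.
Proof.
move=> supAx; rewrite /bigjoin /supremum; case: ifPn => [/eqP A0|_].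
  (* The default [\bot] is returned on the empty set, whose least upper bound is [\bot] as well. *)
  by apply/esym/eqP; rewrite -lex0; apply: supAx.2; rewrite A0.
case: xgetP => [y _ supAy|/(_ x)//].
exact: (@is_subset1_supremums _ _ A).
Qed.

Lemma bigjoin2 d (T : tbLatticeType d) (x y : T) :
  bigjoin [set x; y]%classic = x `|` y.
Proof.
apply: bigjoin_eq; split=> [z [->|->]|z zub]; rewrite ?leUl ?leUr//.
by rewrite leUx !zub//=; [right|left].
Qed.

Lemma bigjoin_set0 d (T : tbLatticeType d) : bigjoin (@set0 T) = \bot.
Proof. by apply: bigjoin_eq; split=> // z _; rewrite le0x. Qed.

(** A bijection with the labels below 7. Values of [g] beyond 6 are left free, so that tables can be
    plain lists of naturals. *)
Record coding d (T : tbLatticeType d) (J : table) (h : T -> nat)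
    (g : nat -> T) : Prop := Coding {
  coding_hK : cancel h g;
  coding_lt : forall x, (h x < 7)%N;
  coding_gK : forall i, (i < 7)%N -> h (g i) = i;
  coding_bot : h \bot = 0;
  coding_join : forall x y, h (x `|` y) = op J (h x) (h y)
}.

Section Coding.
Context d (T : tbLatticeType d) (J : table) (h : T -> nat) (g : nat -> T).
Hypothesis hg : coding J h g.

Let hK := coding_hK hg.
Let h_lt := coding_lt hg.
Let gK := coding_gK hg.
Let h_inj : injective h := can_inj hK.

Lemma coding_le x y : (x <= y) = tle J (h x) (h y).
Proof. by rewrite leEjoin /tle -(coding_join hg) (inj_eq h_inj). Qed.

(** Finiteness turns the join of any subset into a finite join over labels, with membership decided
    classically. *)
Lemma coding_join_supremums (A : set T) :
  supremums A (\join_(i <- iota 0 7 | `[< A (g i) >]) g i).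
Proof.
split=> [x Ax|x xub].
  rewrite -[leLHS]hK; apply: joins_sup_seq; first by rewrite mem_iota h_lt.
  by rewrite hK; apply/asboolP.
by apply/joinsP_seq => i _ /asboolP; apply: xub.
Qed.

Lemma coding_bigjoinE (A : set T) :
  bigjoin A = \join_(i <- iota 0 7 | `[< A (g i) >]) g i.
Proof. exact/bigjoin_eq/coding_join_supremums. Qed.

Lemma coding_supremums (A : set T) : supremums A (bigjoin A).
Proof. by rewrite coding_bigjoinE; apply: coding_join_supremums. Qed.

Lemma bigjoin_ub (A : set T) x : A x -> x <= bigjoin A.
Proof. exact: (coding_supremums A).1. Qed.

Lemma bigjoin_le (A : set T) y :
  (forall x, A x -> x <= y) -> bigjoin A <= y.
Proof. exact: (coding_supremums A).2. Qed.

Lemma coding_complete : complete_lattice T.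
Proof.
move=> A; split; first by exists (bigjoin A); apply: coding_supremums.
exists (bigjoin (lbound A)); split=> [x Ax|x xlb]; last exact: bigjoin_ub.
by apply: bigjoin_le => y; apply.
Qed.

Lemma coding_tjoin (P : nat -> bool) :
  h (\join_(i <- iota 0 7 | P i) g i) = tjoin J P.
Proof.
rewrite -big_filter /tjoin; have : all (gtn 7) (filter P (iota 0 7)).
  by apply/allP => i; rewrite mem_filter mem_iota => /andP[].
elim: (filter _ _) => [|i s IHs] /=; first by rewrite big_nil (coding_bot hg).
by case/andP => i7 /IHs{}IHs; rewrite big_cons (coding_join hg) IHs gK.
Qed.

Lemma coding_bigjoin (A : set T) (P : nat -> bool) :
  (forall x, A x <-> P (h x)) -> h (bigjoin A) = tjoin J P.
Proof.
move=> AP; rewrite coding_bigjoinE -coding_tjoin.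
rewrite big_seq_cond [in RHS]big_seq_cond; congr (h _); apply: eq_bigl => i.
rewrite mem_iota /=; case: ltnP => //= i7.
by rewrite -{2}(gK i7); apply/asboolP/idP => /AP.
Qed.

Lemma coding_meet x y : h (x `&` y) = tmeet J (h x) (h y).
Proof.
rewrite /tmeet -(@coding_bigjoin [set z | (z <= x `&` y)%O]%classic).
  congr h; apply/esym/bigjoin_eq; split=> [z //|z]; apply.
  exact: lexx.
by move=> z /=; rewrite lexI !coding_le.
Qed.

(** By finiteness, preserving [\bot] and binary joins is enough. This serves both for meeting with
    the unit and for the translations of a quantale. *)
Lemma bigjoin_morph (f : T -> T) (A : set T) :
    f \bot = \bot -> {morph f : x y / x `|` y} ->
  f (bigjoin A) = bigjoin [set f x | x in A]%classic.
Proof.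
move=> f0 fU; apply/esym/bigjoin_eq; split=> [_ [x Ax <-]|y yub].
  by rewrite leEjoin -fU (join_r (bigjoin_ub Ax)).
rewrite coding_bigjoinE (big_morph f fU f0).
by apply/joinsP_seq => i _ /asboolP Ai; apply: yub; exists (g i).
Qed.

Lemma coding_latticeb : latticeb J.
Proof.
apply/and4P; split.
- apply/all2_7P => i j /gK <- /gK <-; by rewrite -(coding_join hg).
- apply/all7P => i /gK <-; rewrite -(coding_bot hg) -!coding_le lexx le0x /=.
  rewrite -(@coding_bigjoin setT)// -coding_le.
  exact: bigjoin_ub.
- apply/all2_7P => i j /gK <- /gK <-; rewrite -!coding_le.
  by apply/implyP => /le_anti->.
- apply/all3_7P => i j k /gK <- /gK <- /gK <-.
  rewrite -(coding_join hg) -coding_meet -!coding_le leUx lexI !eqxx !andbT.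
  by apply/implyP => /andP[]; apply: le_trans.
Qed.

(* The complement of the principal filter of [b] is the largest set none of
   whose elements is above [b]. *)
Lemma totally_belowE (b a : T) :
  totally_below b a <->
  ~~ tle J (h a) (tjoin J (fun c => ~~ tle J (h b) c)).
Proof.
rewrite -(@coding_bigjoin [set c | ~~ (b <= c)%O]%classic); last first.
  by move=> x /=; rewrite coding_le.
rewrite -coding_le; split=> [ba|/negP nle A aA].
  by apply/negP => /ba[c /negP].
apply: contrapT => nA; apply: nle; apply: le_trans aA _.
apply: bigjoin_le => c Ac; apply: bigjoin_ub => /=; apply/negP => bc.
by apply: nA; exists c.
Qed.

Lemma goodP (e : T) :
  good J (h e) <->
  bigjoin [set a : T | totally_below a e]%classic = e /\
  exists A : set T,
    ~ (e `&` bigjoin A <= bigjoin [set (e `&` a)%O | a in A]%classic).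
Proof.
have tbE : h (bigjoin [set a | totally_below a e]%classic) =
    tjoin J (fun b => ~~ tle J (h e) (tjoin J (fun c => ~~ tle J b c))).
  by apply: coding_bigjoin => x; apply: totally_belowE.
rewrite /good -tbE (inj_eq h_inj); case: eqP => [tbe|tbNe]; last by split=> [|[]].
split=> [nd|[_ [A ndA]]].
  split=> //; apply: contrapT => /forallNP dist.
  apply: (negP nd); apply/all2_7P => i j.
  move=> /gK <- /gK <-.
  rewrite -(coding_join hg) -!coding_meet -(coding_join hg) -coding_le.
  have /contrapT := dist [set g i; g j]%classic.
  by rewrite image_setU !image_set1 !bigjoin2.
(* If every pair distributes, meeting with [e] preserves [\bot] and binary joins, hence all joins,
   against the choice of [A]. *)
apply/negP => /all2_7P dist; apply: ndA.
rewrite (@bigjoin_morph (Order.meet e)) ?meetx0// => x y.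
apply/le_anti/andP; split; last by rewrite leUx !leI2 ?leUl ?leUr.
have := dist (h x) (h y) (h_lt x) (h_lt y).
by rewrite -(coding_join hg) -!coding_meet -(coding_join hg) -coding_le.
Qed.

(** Renames labels by a permutation fixing the bottom, with [index] as inverse. It later moves the
    unit to label 4 and the order onto a listed lattice. *)
Lemma coding_relabel (p : seq nat) (J' : table) :
    perm_eq p (iota 0 7) -> nth 0 p 0 = 0 ->
    (forall i j, (i < 7)%N -> (j < 7)%N ->
       nth 0 p (op J i j) = op J' (nth 0 p i) (nth 0 p j)) ->
  coding J' (fun x => nth 0 p (h x)) (fun i => g (index i p)).
Proof.
move=> pp p0 pJ.
have p_size : size p = 7 by rewrite (perm_size pp).
have p_uniq : uniq p by rewrite (perm_uniq pp) iota_uniq.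
split=> [x|x|i i7||x y].
- by rewrite index_uniq ?p_size.
- have : nth 0 p (h x) \in p by rewrite mem_nth ?p_size.
  by rewrite (perm_mem pp) mem_iota.
- have ip : i \in p by rewrite (perm_mem pp) mem_iota.
  by rewrite gK ?nth_index// -p_size index_mem.
- by rewrite (coding_bot hg).
- by rewrite (coding_join hg) pJ.
Qed.

End Coding.

(** * Enumeration of orders through linear extensions *)

Definition down_trans (D : seq bitseq) : bool :=
  let js := iota 0 (size D) in
  allb (fun j => allb (fun i =>
    if nth false (nth [::] D j) i then
      all7 (fun l => nth false (nth [::] D i) l ==> nth false (nth [::] D j) l)
    else true) js) js.

(* Row [j] is the indicator of the principal down-set of [j]; in a natural
   labelling (a linear extension) it is lower triangular, 0 is the bottom and
   6 is the top. *)
Definition down_rows (j : nat) : seq bitseq :=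
  search (fun i => if (i == 0) || (i == j) || (j == 6) then [:: true]
                   else if (j < i)%N then [:: false] else [:: false; true])
         xpredT 7.

(** The free entries are the pairs with [0 < i < j < 6], ten in all; transitivity is tested each
    time a row is added. *)
Definition natural_orders : seq (seq bitseq) := search down_rows down_trans 7.

(* The first common upper bound is the join when labels are natural. *)
Definition join_of (D : seq bitseq) : table :=
  mktable (fun i j =>
    find (fun k => nth false (nth [::] D k) i && nth false (nth [::] D k) j)
         (iota 0 7)).

Lemma card7_enum (T : choiceType) :
    ([set: T] #= `I_7)%card ->
  exists s : seq T, [/\ uniq s, size s = 7 & forall x, x \in s].
Proof.
move/card_set_bijP => [f [f7 finj fsurj]].
have [g fgK] : exists g : nat -> T, forall i, (i < 7)%N -> f (g i) = i.
  have [x0 _ _] := fsurj 0 isT.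
  have /choice[g gP] i : exists x, (i < 7)%N -> f x = i.
    case: (ltnP i 7) => [/fsurj[x _ <-]|_]; last by exists x0.
    by exists x.
  by exists g.
exists (mkseq g 7); split; last 2 first.
- by rewrite size_mkseq.
- move=> x; apply/mapP; exists (f x); first by rewrite mem_iota; apply: f7.
  by apply: finj; rewrite ?inE// fgK//; apply: f7.
apply/mkseq_uniqP => i j; rewrite !inE => i7 j7 /(congr1 f).
by rewrite !fgK.
Qed.

(** Sorting by the size of the principal down-set works because that size grows strictly along the
    strict order. *)
Lemma linear_extension d (T : porderType d) (s : seq T) :
    uniq s -> (forall x, x \in s) ->
  exists t : seq T, [/\ uniq t, size t = size s, forall x, x \in t
    & {homo index^~ t : x y / x <= y >-> (x <= y)%N}].
Proof.
move=> s_uniq sT; pose down x := count (fun y => y <= x) s.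
pose r x y := (down x <= down y)%N.
have r_tot : total r by move=> x y; apply: leq_total.
have r_tr : transitive r by move=> y x z; apply: leq_trans.
have tT x : x \in sort r s by rewrite mem_sort.
exists (sort r s); split=> // [||x y xy].
- by rewrite sort_uniq.
- by rewrite size_sort.
rewrite leqNgt; apply/negP => yx.
have down_yx : (down y <= down x)%N.
  have := sorted_ltn_nth r_tr x (sort_sorted r_tot s) (index y (sort r s)) (index x (sort r s)).
  rewrite !inE !index_mem !tT => /(_ isT isT yx).
  by rewrite !nth_index.
suff : (down x < down y)%N by rewrite ltnNge down_yx.
have ltxy : x < y by rewrite lt_neqAle xy andbT; apply: contraTneq yx => ->; rewrite ltnn.
(* The down-set of [x] together with [y] is a duplicate-free list inside the down-set of [y]. *)
rewrite /down -!size_filter; apply: uniq_leq_size (y :: _) _ _ _.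
- by rewrite /= filter_uniq// mem_filter andbT lt_geF.
move=> z; rewrite inE !mem_filter => /predU1P[->|/andP[zx zs]].
  by rewrite lexx sT.
by rewrite zs andbT (le_trans zx).
Qed.

Lemma natural_coding d (T : tbLatticeType d) :
    ([set: T] #= `I_7)%card ->
  exists D h g, D \in natural_orders /\ @coding d T (join_of D) h g.
Proof.
move=> /card7_enum[s [s_uniq s7 sT]].
have [t [t_uniq t7 tT h_homo]] := linear_extension s_uniq sT.
rewrite s7 in t7; pose h x := index x t; pose g := nth \bot t.
have h_lt x : (h x < 7)%N by rewrite -t7 index_mem.
have hK : cancel h g by move=> x; apply: nth_index.
have gK i : (i < 7)%N -> h (g i) = i by move=> i7; rewrite /h index_uniq ?t7.
have g_le i j : (i < 7)%N -> (j < 7)%N -> g i <= g j -> (i <= j)%N.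
  by move=> i7 j7 /h_homo; rewrite -!/(h _) !gK.
have g0 : g 0 = \bot.
  rewrite -[RHS]hK; congr g; apply/esym/eqP; rewrite -leqn0 -(gK 0)//.
  exact/h_homo/le0x.
have g6 : g 6 = \top.
  rewrite -[RHS]hK; congr g; apply/eqP.
  rewrite eqn_leq; apply/andP; split; last exact: h_lt.
  by rewrite -(gK 6)//; apply/h_homo/lex1.
pose D := mkseq (fun j => mkseq (fun i => g i <= g j) 7) 7.
exists D, h, g; split.
  apply: mkseq_search => [j j7|n n7].
    apply: mkseq_search => // i i7.
    have [->|_/=] := eqVneq i 0; first by rewrite g0 le0x.
    have [->|_/=] := eqVneq i j; first by rewrite lexx.
    have [->|_/=] := eqVneq j 6; first by rewrite g6 lex1.
    case: ifPn => [ji|_]; last by case: (_ <= _).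
    rewrite inE eqbF_neg; apply: contraTN ji => /(g_le _ _ i7 j7).
    by rewrite -leqNgt.
  rewrite /down_trans size_mkseq; apply/allb_iotaP => j jn.
  apply/allb_iotaP => i ilt.
  rewrite !nth_mkseq ?(leq_trans _ n7)//; case: ifP => // gij.
  apply/all7P => l l7; rewrite !nth_mkseq//.
  by apply/implyP => gli; apply: le_trans gij.
split=> // [|x y]; first by rewrite -g0 gK.
rewrite op_mkseq//.
(* [P k] says that [k] labels a common upper bound. The label of the join satisfies it, so the first
   such [k] is at most that label; conversely an upper bound lies above the join, and labels respect
   the order. *)
set P := fun k : nat => _; set k := find P _.
have PE i : (i < 7)%N -> P i = (x `|` y <= g i).
  by move=> i7; rewrite /P !nth_mkseq// !hK leUx.
have k_le : (k <= h (x `|` y))%N.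
  rewrite leqNgt; apply/negP => /(before_find 0).
  by rewrite nth_iota// add0n PE// hK lexx.
have k7 : (k < 7)%N by apply: leq_ltn_trans k_le _.
apply/eqP; rewrite eqn_leq k_le andbT -(gK k)//; apply: h_homo.
have : has P (iota 0 7) by rewrite has_find size_iota.
by move/(nth_find 0); rewrite -/k nth_iota// add0n PE.
Qed.

(** * Isomorphism of tables and the search for multiplications *)

Definition perms : seq (seq nat) :=
  [seq p <- permutations (iota 0 7) | nth 0 p 0 == 0].

Definition transports (p : seq nat) (t t' : table) : bool :=
  all2_7 (fun i j => nth 0 p (op t i j) == op t' (nth 0 p i) (nth 0 p j)).

(* The labels 0 and 4 are those of the bottom element and of the unit. *)
Definition iso_tables (S S' : table * table) : bool :=
  hasb (fun p => if nth 0 p 4 == 4 then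
                   if transports p S.1 S'.1 then transports p S.2 S'.2
                   else false
                 else false) perms.

(* [endo_ok] and [mul_ok] test a prefix of a table: an equation is checked only
   once the entries that it mentions are known. *)
Definition endo_ok (J : table) (f : seq nat) : bool :=
  let n := size f in let js := iota 0 n in
  if nth 0 f 0 == 0 then
  allb (fun i => allb (fun j =>
    if (op J i j < n)%N
    then nth 0 f (op J i j) == op J (nth 0 f i) (nth 0 f j)
    else true) js) js
  else false.

Definition endos (J : table) : seq (seq nat) :=
  search (fun=> iota 0 7) (endo_ok J) 7.

Definition mul_ok (J M : table) : bool :=
  let n := size M in let js := iota 0 n in
  if allb (fun i => allb (fun j =>
       if (op J i j < n)%N
       then all7 (fun k => op M (op J i j) k == op J (op M i k) (op M j k))
       else true) js) js then
  if all7 (fun k => op M 0 k == 0) then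
  if (if (4 < n)%N then all7 (fun k => op M 4 k == k) else true) then
  allb (fun i => allb (fun j =>
    if (op M i j < n)%N
    then all7 (fun k => op M (op M i j) k == op M i (op M j k))
    else true) js) js
  else false else false else false.

(* Row [a] is the left translation by [a], an endomorphism sending the unit
   to [a]. *)
Definition muls (J : table) : seq table :=
  let es := endos J in
  search (fun a => [seq f <- es | nth 0 f 4 == a]) (mul_ok J) 7.

(** By finiteness, bottom and binary joins stand for arbitrary joins. The full axioms are tested
    here, independently of the pruned search. *)
Definition quantaleb (J M : table) : bool :=
  [&& all2_7 (fun i j => (op M i j < 7)%N),
      all7 (fun i => [&& op M 0 i == 0, op M i 0 == 0, op M 4 i == i
                       & op M i 4 == i])
    & all3_7 (fun i j k =>
        [&& op M i (op M j k) == op M (op M i j) k,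
            op M i (op J j k) == op J (op M i j) (op M i k)
          & op M (op J i j) k == op J (op M i k) (op M j k)])].

Definition commutativeb (M : table) : bool :=
  all2_7 (fun i j => op M i j == op M j i).

(** * Quantales represented by a pair of tables *)

Lemma qmul_joinr2 (Q : quantale) (a : Q) :
  {morph qmul a : x y / x `|` y}.
Proof.
move=> x y; rewrite -!bigjoin2 qmul_joinr; congr bigjoin.
by rewrite image_setU !image_set1.
Qed.

Lemma qmul_joinl2 (Q : quantale) (a : Q) :
  {morph (@qmul Q)^~ a : x y / x `|` y}.
Proof.
move=> x y /=; rewrite -!bigjoin2 qmul_joinl; congr bigjoin.
by rewrite image_setU !image_set1.
Qed.

Lemma qmulq0 (Q : quantale) (a : Q) : qmul a \bot = \bot.
Proof. by rewrite -bigjoin_set0 qmul_joinr image_set0. Qed.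

Lemma qmul0q (Q : quantale) (a : Q) : qmul \bot a = \bot.
Proof. by rewrite -bigjoin_set0 qmul_joinl image_set0. Qed.

Record qcoding (Q : unital_quantale) (S : table * table) (h : Q -> nat)
    (g : nat -> Q) : Prop := QCoding {
  qcoding_lattice : coding S.1 h g;
  qcoding_one : h (qone Q) = 4;
  qcoding_mul : forall x y : Q, h (qmul x y) = op S.2 (h x) (h y)
}.

Definition represents (Q : unital_quantale) (S : table * table) : Prop :=
  exists h g, @qcoding Q S h g.

Lemma mem_perms p : p \in perms = perm_eq p (iota 0 7) && (nth 0 p 0 == 0).
Proof. by rewrite mem_filter mem_permutations andbC. Qed.

Lemma transportsP p t t' :
  reflect (forall i j, (i < 7)%N -> (j < 7)%N ->
             nth 0 p (op t i j) = op t' (nth 0 p i) (nth 0 p j))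
          (transports p t t').
Proof.
apply: (iffP (all2_7P _)) => [pt i j i7 j7|pt i j i7 j7]; apply/eqP/pt => //.
Qed.

Lemma iso_tablesP S S' :
  reflect (exists p, [/\ p \in perms, nth 0 p 4 = 4, transports p S.1 S'.1
                       & transports p S.2 S'.2])
          (iso_tables S S').
Proof.
rewrite /iso_tables hasbE; apply: (iffP hasP) => [[p pp]|[p [pp p4 p1 p2]]].
  by case: eqP => // p4; case: ifP => // p1 p2; exists p.
by exists p => //; rewrite p4 eqxx p1.
Qed.

Lemma represents_iso (Q : unital_quantale) S S' :
  represents Q S -> iso_tables S S' -> represents Q S'.
Proof.
move=> [h [g [hgJ h1 hM]]] /iso_tablesP[p [pp p4 /transportsP p1 /transportsP p2]].
move: pp; rewrite mem_perms => /andP[pp /eqP p0].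
exists (fun x => nth 0 p (h x)), (fun i => g (index i p)); split.
- exact: (coding_relabel hgJ).
- by rewrite h1.
- by move=> x y; rewrite hM p2// (coding_lt hgJ).
Qed.

Lemma represents_isomorphic (Q Q' : unital_quantale) S :
  represents Q S -> represents Q' S -> isomorphic Q Q'.
Proof.
move=> [h [g [hgJ h1 hM]]] [h' [g' [hgJ' h1' hM']]].
have h_lt := coding_lt hgJ.
have h'f x : h' (g' (h x)) = h x by rewrite (coding_gK hgJ').
have h'_inj := can_inj (coding_hK hgJ').
exists (fun x => g' (h x)); split.
- exists (fun y => g (h' y)) => x.
    by rewrite h'f (coding_hK hgJ).
  by rewrite (coding_gK hgJ) ?(coding_hK hgJ')// (coding_lt hgJ').
- move=> x y; apply: h'_inj.
  by rewrite (coding_meet hgJ') !h'f (coding_meet hgJ).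
- move=> x y; apply: h'_inj.
  by rewrite (coding_join hgJ') !h'f (coding_join hgJ).
- by move=> x y; apply: h'_inj; rewrite hM' !h'f hM.
Qed.

(** Read through both labellings, an isomorphism is a permutation of labels. It fixes 0 and 4
    because bottom and unit are preserved automatically. *)
Lemma isomorphic_iso_tables (Q Q' : unital_quantale) S S' :
  represents Q S -> represents Q' S' -> isomorphic Q Q' -> iso_tables S S'.
Proof.
move=> [h [g [hgJ h1 hM]]] [h' [g' [hgJ' h1' hM']]] [f [f_bij _ fU fM]].
have [f' fK f'K] := f_bij.
have gK := coding_gK hgJ; have hK := coding_hK hgJ.
(* Surjectivity writes [\bot] as [f (f' \bot)], and [\bot] lies below [f' \bot]. *)
have f0 : f \bot = \bot.
  by apply/eqP; rewrite -lex0 -[\bot in leRHS]f'K leEjoin -fU join0x.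
(* Likewise [qone Q'] is an image, and [f (qone Q)] acts as a unit on images. *)
have f1 : f (qone Q) = qone Q'.
  by rewrite -[LHS]qmulq1 -[qone Q' in LHS]f'K -fM qmul1q f'K.
pose p := mkseq (fun i => h' (f (g i))) 7.
have pE x : nth 0 p (h x) = h' (f x).
  by rewrite nth_mkseq ?(coding_lt hgJ)// hK.
apply/iso_tablesP; exists p; split.
- rewrite mem_perms -[X in nth 0 p X](coding_bot hgJ) pE f0 (coding_bot hgJ').
  rewrite andbT; have p_uniq : uniq p.
    apply/mkseq_uniqP => i j; rewrite !inE => i7 j7.
    move=> /(can_inj (coding_hK hgJ'))/(can_inj fK)/(congr1 h).
    by rewrite !gK.
  have p_sub : {subset p <= iota 0 7}.
    by move=> _ /mapP[i _ ->]; rewrite mem_iota (coding_lt hgJ').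
  apply: uniq_perm => //.
  by have [|_] := uniq_min_size p_uniq p_sub; rewrite ?size_mkseq.
- by rewrite -[X in nth 0 p X]h1 pE f1.
- apply/transportsP => i j /gK <- /gK <-.
  by rewrite -(coding_join hgJ) !pE fU (coding_join hgJ').
- by apply/transportsP => i j /gK <- /gK <-; rewrite -hM !pE fM hM'.
Qed.

Lemma represents_commutative (Q : unital_quantale) S :
  represents Q S -> commutative_quantale Q <-> commutativeb S.2.
Proof.
move=> [h [g [hgJ h1 hM]]]; split=> [Qc|/all2_7P Sc x y].
  by apply/all2_7P => i j /(coding_gK hgJ)<- /(coding_gK hgJ)<-; rewrite -!hM Qc.
apply: (can_inj (coding_hK hgJ)); rewrite !hM.
by apply/eqP/Sc; apply: (coding_lt hgJ).
Qed.

Lemma represents_good (Q : unital_quantale) S :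
  represents Q S -> unitally_nondistributive Q <-> good S.1 4.
Proof.
by move=> [h [g [hgJ <- hM]]]; split=> [/(goodP hgJ)|/(goodP hgJ)].
Qed.

Lemma represents_card (Q : unital_quantale) S :
  represents Q S -> has_card 7 Q.
Proof.
move=> [h [g [hgJ _ _]]]; apply/card_set_bijP; exists h; split=> [x _|x y _ _|i i7].
- exact: (coding_lt hgJ).
- exact: (can_inj (coding_hK hgJ)).
- by exists (g i) => //; apply: (coding_gK hgJ).
Qed.

(** Every equation tested on a prefix holds in the quantale itself, so its actual multiplication
    table survives all pruning. *)
Lemma coding_muls (Q : unital_quantale) J h g :
    @coding _ Q J h g -> h (qone Q) = 4 ->
  exists2 M, M \in muls J & represents Q (J, M).
Proof.
move=> hgJ h1.
have gK := coding_gK hgJ; have hK := coding_hK hgJ; have h_lt := coding_lt hgJ.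
pose M i j := h (qmul (g i) (g j)).
have gJ i j : (i < 7)%N -> (j < 7)%N -> g (op J i j) = g i `|` g j.
  by move=> i7 j7; rewrite -[RHS]hK (coding_join hgJ) !gK.
have gM i j : g (M i j) = qmul (g i) (g j) by apply: hK.
have g0 : g 0 = \bot by rewrite -(coding_bot hgJ) hK.
have g1 : g 4 = qone Q by rewrite -h1 hK.
exists (mktable M); last first.
  exists h, g; split=> // x y.
  by rewrite op_mkseq//= /M !hK.
apply: mkseq_search => [a a7|n n7].
  rewrite mem_filter nth_mkseq// {1}/M g1 qmulq1 gK// eqxx /=.
  apply: mkseq_search => [b b7|n n7]; first by rewrite mem_iota h_lt.
  rewrite /endo_ok size_mkseq ifT; last first.
    (* On the empty prefix the default 0 of [nth] passes the test. *)
    case: n n7 => // n _.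
    by rewrite nth_mkseq// /M g0 qmulq0 (coding_bot hgJ).
  apply/allb_iotaP => i iltn; apply/allb_iotaP => j jltn; case: ifP => // ijn.
  rewrite !nth_mkseq// /M gJ ?(leq_trans _ n7)//.
  by rewrite qmul_joinr2 (coding_join hgJ).
rewrite /mul_ok size_mkseq ifT; last first.
  apply/allb_iotaP => i iltn; apply/allb_iotaP => j jltn; case: ifP => // ijn.
  apply/all7P => k k7; rewrite !op_mkseq// /M gJ ?(leq_trans _ n7)//.
  by rewrite qmul_joinl2 (coding_join hgJ).
rewrite ifT; last first.
  apply/all7P => k k7; case: n n7 => [|n] _; first by rewrite /op !nth_nil.
  by rewrite op_mkseq// /M g0 qmul0q (coding_bot hgJ).
rewrite ifT; last first.
  case: ifP => // lt4n; apply/all7P => k k7.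
  by rewrite op_mkseq// /M g1 qmul1q gK.
apply/allb_iotaP => i iltn; apply/allb_iotaP => j jltn.
have j7 := leq_trans jltn n7.
rewrite op_mkseq//; case: ifP => // ijn; apply/all7P => k k7.
by rewrite !op_mkseq//; [rewrite /M !hK qmulA|apply: h_lt].
Qed.

(** * Construction of a unital quantale from valid tables *)

Section Model.
Variables (J M : table).
Hypothesis J_lattice : latticeb J.
Hypothesis JM_quantale : quantaleb J M.

Let lattice_facts := and4P J_lattice.

(** The alias carries the lattice hypothesis as an argument, so that the order of the table can be
    declared on it while ['I_7] keeps its usual linear order. *)
Definition model of latticeb J : Type := 'I_7.
Local Notation T := (model J_lattice).

HB.instance Definition _ := Finite.on T.

Let mle (x y : T) : bool := tle J x y.
Let mjoin (x y : T) : T := inord (op J x y) : 'I_7.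
Let mmeet (x y : T) : T := inord (tmeet J x y) : 'I_7.
Let mmul (x y : T) : T := inord (op M x y) : 'I_7.

Lemma tjoin_lt (P : nat -> bool) : (tjoin J P < 7)%N.
Proof.
have [/all2_7P J7 _ _ _] := lattice_facts.
rewrite /tjoin; have : all (gtn 7) (filter P (iota 0 7)).
  by apply/allP => i; rewrite mem_filter mem_iota => /andP[].
by elim: (filter _ _) => //= i s IHs /andP[i7 /IHs]; apply: J7.
Qed.

Lemma mjoinE (x y : T) : mjoin x y = op J x y :> nat.
Proof.
have [/all2_7P J7 _ _ _] := lattice_facts.
by rewrite inordK//; apply: J7; apply: ltn_ord.
Qed.

Lemma mmeetE (x y : T) : mmeet x y = tmeet J x y :> nat.
Proof. by rewrite inordK// tjoin_lt. Qed.

Lemma mle_refl : reflexive mle.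
Proof.
have [_ /all7P J0 _ _] := lattice_facts => x.
by have /and3P[] := J0 x (ltn_ord x).
Qed.

Lemma mle_anti : antisymmetric mle.
Proof.
have [_ _ /all2_7P Ja _] := lattice_facts => x y.
by move/(implyP (Ja _ _ (ltn_ord x) (ltn_ord y)))/eqP/val_inj.
Qed.

Lemma mle_trans : transitive mle.
Proof.
have [_ _ _ /all3_7P Jt] := lattice_facts => y x z xy yz.
have /and3P[/implyP + _ _] := Jt _ _ _ (ltn_ord x) (ltn_ord y) (ltn_ord z).
by apply; apply/andP.
Qed.

HB.instance Definition _ :=
  Order.Le_isPOrder.Build (Order.Disp tt tt) T mle_refl mle_anti mle_trans.

Lemma mlexI (x y z : T) : (x <= mmeet y z) = (x <= y) && (x <= z).
Proof.
have [_ _ _ /all3_7P Jt] := lattice_facts.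
have /and3P[_ _ /eqP] := Jt _ _ _ (ltn_ord x) (ltn_ord y) (ltn_ord z).
by rewrite -mmeetE.
Qed.

Lemma mleUx (x y z : T) : (mjoin x y <= z) = (x <= z) && (y <= z).
Proof.
have [_ _ _ /all3_7P Jt] := lattice_facts.
have /and3P[_ /eqP + _] := Jt _ _ _ (ltn_ord x) (ltn_ord y) (ltn_ord z).
by rewrite -mjoinE.
Qed.

HB.instance Definition _ :=
  Order.POrder_MeetJoin_isLattice.Build (Order.Disp tt tt) T mlexI mleUx.

Lemma mle0x (x : T) : ((inord 0 : 'I_7) : T) <= x.
Proof.
have [_ /all7P J0 _ _] := lattice_facts.
have /and3P[_ + _] := J0 x (ltn_ord x).
by rewrite -[X in tle J X](@inordK 6 0).
Qed.

Lemma mlex1 (x : T) : x <= ((inord (tjoin J xpredT) : 'I_7) : T).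
Proof.
have [_ /all7P J0 _ _] := lattice_facts.
have /and3P[_ _] := J0 x (ltn_ord x).
by rewrite -[X in tle J _ X](@inordK 6 (tjoin J xpredT)) ?tjoin_lt.
Qed.

HB.instance Definition _ := Order.hasBottom.Build (Order.Disp tt tt) T mle0x.
HB.instance Definition _ := Order.hasTop.Build (Order.Disp tt tt) T mlex1.

Lemma model_coding :
  @coding _ T J (fun x : 'I_7 => x : nat) (fun i => inord i : 'I_7).
Proof.
split=> [x|x|i i7||x y].
- exact: inord_val.
- exact: ltn_ord.
- by rewrite inordK.
- by rewrite inordK.
- exact: mjoinE.
Qed.

Let mul_facts := and3P JM_quantale.

Lemma mmulE (x y : T) : mmul x y = op M x y :> nat.
Proof.
have [/all2_7P M7 _ _] := mul_facts.
by rewrite inordK//; apply: M7; apply: ltn_ord.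
Qed.

Lemma mmulA : associative mmul.
Proof.
have [_ _ /all3_7P Mt] := mul_facts => x y z; apply: val_inj.
rewrite /= !mmulE.
by have /and3P[/eqP] := Mt _ _ _ (ltn_ord x) (ltn_ord y) (ltn_ord z).
Qed.

Lemma mmul_joinr (a : T) (B : set T) :
  mmul a (bigjoin B) = bigjoin [set mmul a b | b in B]%classic.
Proof.
have [_ /all7P M0 /all3_7P Mt] := mul_facts.
apply: (bigjoin_morph model_coding) => [|x y]; apply: val_inj.
  rewrite /= mmulE [in op _ _ _]inordK//.
  by have /and4P[_ /eqP -> _ _] := M0 a (ltn_ord a); rewrite inordK.
rewrite /= mmulE mjoinE.
have /and3P[_ /eqP -> _] := Mt _ _ _ (ltn_ord a) (ltn_ord x) (ltn_ord y).
by rewrite mjoinE !mmulE.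
Qed.

Lemma mmul_joinl (A : set T) (b : T) :
  mmul (bigjoin A) b = bigjoin [set mmul a b | a in A]%classic.
Proof.
have [_ /all7P M0 /all3_7P Mt] := mul_facts.
apply: (bigjoin_morph (f := mmul^~ b) model_coding) => [|x y]; apply: val_inj.
  rewrite /= mmulE [in op _ _ _]inordK//.
  by have /and4P[/eqP -> _ _ _] := M0 b (ltn_ord b); rewrite inordK.
rewrite /= mmulE mjoinE.
have /and3P[_ _ /eqP ->] := Mt _ _ _ (ltn_ord x) (ltn_ord y) (ltn_ord b).
by rewrite mjoinE !mmulE.
Qed.

Definition model_quantale : quantale :=
  Quantale (coding_complete model_coding) mmulA mmul_joinr mmul_joinl.

Definition model_one : model_quantale := inord 4 : 'I_7.

Lemma model_mul1q : left_id model_one (@qmul model_quantale).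
Proof.
have [_ /all7P M0 _] := mul_facts => x; apply: val_inj.
rewrite /= mmulE [X in op _ X]inordK//.
by have /and4P[_ _ /eqP -> _] := M0 x (ltn_ord x).
Qed.

Lemma model_mulq1 : right_id model_one (@qmul model_quantale).
Proof.
have [_ /all7P M0 _] := mul_facts => x; apply: val_inj.
rewrite /= mmulE [X in op _ _ X]inordK//.
by have /and4P[_ _ _ /eqP ->] := M0 x (ltn_ord x).
Qed.

Definition model_unital : unital_quantale :=
  UnitalQuantale model_mul1q model_mulq1.

Lemma model_represents : represents model_unital (J, M).
Proof.
exists (fun x : 'I_7 => x : nat), (fun i => inord i : 'I_7).
split=> [||x y]; [exact: model_coding|by rewrite /= inordK|exact: mmulE].
Qed.

End Model.

(** * Computations and the count of isomorphism classes *)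

(* Join tables, with unit 4, of the lattices with bottom 0, top 6 and coatoms
   4, 5 in which 1, 3 < 5 and 3 < 4: in the first one 1, 2, 3 are atoms and
   2 < 5, in the second one 0 < 2 < 3. *)
Definition lattices : seq table :=
  [:: [:: [:: 0; 1; 2; 3; 4; 5; 6];
          [:: 1; 1; 5; 5; 6; 5; 6];
          [:: 2; 5; 2; 5; 6; 5; 6];
          [:: 3; 5; 5; 3; 4; 5; 6];
          [:: 4; 6; 6; 4; 4; 6; 6];
          [:: 5; 5; 5; 5; 6; 5; 6];
          [:: 6; 6; 6; 6; 6; 6; 6]];
      [:: [:: 0; 1; 2; 3; 4; 5; 6];
          [:: 1; 1; 5; 5; 6; 5; 6];
          [:: 2; 5; 2; 3; 4; 5; 6];
          [:: 3; 5; 3; 3; 4; 5; 6];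
          [:: 4; 6; 4; 4; 4; 6; 6];
          [:: 5; 5; 5; 5; 6; 5; 6];
          [:: 6; 6; 6; 6; 6; 6; 6]]].

(** Some enumerated orders are not lattices; their tables of first common upper bounds are dropped
    by the [latticeb] guard. *)
Lemma lattices_complete_computation :
  allb (fun D => let J := join_of D in all7 (fun e =>
    if good J e then if latticeb J then
      hasb (fun p => if nth 0 p e == 4 then hasb (transports p J) lattices
                     else false) perms
    else true else true)) natural_orders.
Proof. by vm_compute. Qed.

(** A table is kept unless it is isomorphic to one already kept. Evaluating the definition stores
    the list itself, so later computations do not repeat the search. *)
Definition reps : seq (table * table) := Eval vm_compute in
  foldr (fun S acc => if hasb (iso_tables S) acc then acc else S :: acc) [::]
    [seq (J, M) | J <- lattices, M <- muls J].

Lemma reps_complete_computation :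
  allb (fun J => allb (fun M => hasb (iso_tables (J, M)) reps) (muls J)) lattices.
Proof. by vm_compute. Qed.

(** Ensures that distinct listed tables give non-isomorphic quantales. *)
Lemma reps_rigid_computation :
  allb (fun S => allb (fun S' => if iso_tables S S' then S == S' else true) reps)
    reps.
Proof. by vm_compute. Qed.

(** Makes each listed pair realizable by a model, without relying on the search that produced it. *)
Lemma reps_valid_computation :
  allb (fun S => [&& latticeb S.1, quantaleb S.1 S.2 & good S.1 4]) reps.
Proof. by vm_compute. Qed.

Lemma reps_size_computation :
  [&& uniq reps, size reps == 30
    & size [seq S <- reps | ~~ commutativeb S.2] == 2].
Proof. by vm_compute. Qed.

Lemma iso_tables_reps S S' :
  S \in reps -> S' \in reps -> iso_tables S S' -> S = S'.
Proof.
move=> SR S'R iSS'; have := reps_rigid_computation.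
rewrite allbE => /allP/(_ _ SR); rewrite allbE => /allP/(_ _ S'R).
by rewrite iSS' => /eqP.
Qed.

Lemma reps_valid S :
  S \in reps -> [/\ latticeb S.1, quantaleb S.1 S.2 & good S.1 4].
Proof.
by move=> SR; have := reps_valid_computation; rewrite allbE => /allP/(_ _ SR)/and3P.
Qed.

Lemma reps_complete (Q : unital_quantale) :
    unitally_nondistributive Q -> has_card 7 Q ->
  exists2 S, S \in reps & represents Q S.
Proof.
move=> Qnd /natural_coding[D [h [g [Dnat hgJ]]]].
have e7 := coding_lt hgJ (qone Q).
have := lattices_complete_computation; rewrite allbE => /allP/(_ _ Dnat).
move=> /all7P/(_ _ e7); have /(goodP hgJ) -> := Qnd.
rewrite (coding_latticeb hgJ) hasbE => /hasP[p pP].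
case: eqP => // p1; rewrite hasbE => /hasP[J JL /transportsP pJ].
move: pP; rewrite mem_perms => /andP[pp /eqP p0].
(* Relabelling along [p] puts the unit at 4 and the order onto the listed lattice, where the
   multiplication search applies. *)
have [M MJ QM] := coding_muls (coding_relabel hgJ pp p0 pJ) p1.
have := reps_complete_computation; rewrite allbE => /allP/(_ _ JL).
rewrite allbE => /allP/(_ _ MJ); rewrite hasbE => /hasP[S SR iS].
by exists S => //; apply: represents_iso iS.
Qed.

(** Stated for any duplicate-free part of [reps], so that one argument counts both all classes and
    the non-commutative ones. *)
Lemma reps_exactly (rs : seq (table * table)) (P : unital_quantale -> Prop) n :
    uniq rs -> size rs = n -> {subset rs <= reps} ->
    (forall Q S, S \in rs -> represents Q S -> P Q) ->
    (forall Q, P Q -> exists2 S, S \in rs & represents Q S) ->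
  exactly_up_to_iso n P.
Proof.
move=> rs_uniq <- rs_reps rsP Prs; pose S0 : table * table := ([::], [::]).
have nth_rs (i : 'I_(size rs)) : nth S0 rs i \in rs by apply: mem_nth.
have /choice[rep repP] (i : 'I_(size rs)) : exists Q, represents Q (nth S0 rs i).
  have := reps_valid (rs_reps _ (nth_rs i)).
  case: (nth _ _ _) => J M [/= lat qua _]; exists (model_unital lat qua).
  exact: model_represents.
exists rep; split=> [i|i j repij|Q /Prs[S Srs QS]].
- exact: rsP (nth_rs i) (repP i).
- apply/val_inj/eqP; rewrite -(nth_uniq S0 (ltn_ord i) (ltn_ord j) rs_uniq).
  apply/eqP/iso_tables_reps; [exact/rs_reps/nth_rs|exact/rs_reps/nth_rs|].
  exact: isomorphic_iso_tables (repP i) (repP j) repij.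
- have i_lt : (index S rs < size rs)%N by rewrite index_mem.
  exists (Ordinal i_lt); apply: represents_isomorphic QS _.
  by have := repP (Ordinal i_lt); rewrite /= nth_index.
Qed.

Theorem mainTheorem3 :
  exactly_up_to_iso 30
    (fun Q => unitally_nondistributive Q /\ has_card 7 Q) /\
  exactly_up_to_iso 2
    (fun Q => [/\ unitally_nondistributive Q, has_card 7 Q &
                  ~ commutative_quantale Q]).
Proof.
have /and3P[reps_uniq /eqP size_reps /eqP size_nc] := reps_size_computation.
have repsP Q S : S \in reps -> represents Q S ->
    unitally_nondistributive Q /\ has_card 7 Q.
  move=> SR QS; split; last exact: represents_card QS.
  by apply/(represents_good QS); have [] := reps_valid SR.
split.
  by apply: reps_exactly size_reps _ _ _ => // Q [/reps_complete] /[apply].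
(* Commutativity is read off the table, so the non-commutative classes are counted by the filtered
   list. *)
apply: reps_exactly size_nc _ _ _ => [|S|Q S|Q [Qnd Q7 Qnc]].
- exact: filter_uniq.
- by rewrite mem_filter => /andP[].
- rewrite mem_filter => /andP[Snc SR] QS; have [Qnd Q7] := repsP _ _ SR QS.
  by split=> // /(represents_commutative QS); apply/negP.
- have [S SR QS] := reps_complete Qnd Q7; exists S => //.
  by rewrite mem_filter SR andbT; apply/negP => /(represents_commutative QS).
Qed.
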